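(* Even when the output label weight $\kappa$ approaches $\infty$ in the distributionally robust logistic regression problem $$ \mathop{\text{minimize}}_{\bm{\beta} = (\beta_0, \bm{\beta}_{\text{N}}, \bm{\beta}_{\text{C}}) \in \mathbb{R}^{1+n+k}} \;\; \sup_{\mathbb{Q} \in \mathfrak{B}_\epsilon(\widehat{\mathbb{P}}_N)} \mathbb{E}_{\mathbb{Q}}\left[ l_{\bm{\beta}}(\bm{x}, \bm{z}, y) \right], $$ this problem does not admit an equivalent reformulation $$ \mathop{\text{minimize}}_{\bm{\beta} = (\beta_0, \bm{\beta}_{\text{N}}, \bm{\beta}_{\text{C}}) \in \mathbb{R}^{1+n+k}} \;\; \mathbb{E}_{\widehat{\mathbb{P}}_N}\left[ l_{\bm{\beta}}(\bm{x}, \bm{z}, y) \right] + \mathfrak{R}(\bm{\beta}) $$ as a classical regularized logistic regression for any regularizer $\mathfrak{R} : \mathbb{R}^{1+n+k} \to \mathbb{R}$.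
   Context: Notation: $[N] = \{1, \ldots, N\}$, $\mathbb{B} = \{0,1\}$; $\mathbf{1}[\mathcal{E}]$ is $1$ if $\mathcal{E}$ holds and $0$ otherwise; $\mathcal{P}_0(\Xi)$ is the set of probability distributions supported on $\Xi$; $\delta_{\bm{\xi}}$ is the Dirac distribution at $\bm{\xi}$. Features: the setting is one in which categorical features are present. There are $n$ numerical features $\bm{x} \in \mathbb{R}^n$, $m$ categorical features $\bm{z} = (\bm{z}_1, \ldots, \bm{z}_m) \in \mathbb{C} := \mathbb{C}(k_1) \times \cdots \times \mathbb{C}(k_m)$, where $\mathbb{C}(s) = \{\bm{z} \in \mathbb{B}^{s-1} : \sum_{j \in [s-1]} z_j \leq 1\}$ is the one-hot encoding of a categorical feature with $s \geq 2$ possible values, and a label $y \in \{-1,+1\}$. Set $\Xi = \mathbb{R}^n \times \mathbb{C} \times \{-1,+1\}$ and $k = k_1 + \cdots + k_m - m$. The data set is $\bm{\xi}^i = (\bm{x}^i, \bm{z}^i, y^i) \in \Xi$, $i \in [N]$. A regularizer $\mathfrak{R}$ is data-independent. Log-loss: $l_{\bm{\beta}} (\bm{x}, \bm{z}, y) = \log ( 1 + \exp [ -y \cdot ( \beta_0 + \bm{\beta}_{\text{N}}^\top \bm{x} + \bm{\beta}_{\text{C}}^\top \bm{z} ) ] )$ for $\bm{\beta} = (\beta_0, \bm{\beta}_{\text{N}}, \bm{\beta}_{\text{C}}) \in \mathbb{R} \times \mathbb{R}^n \times \mathbb{R}^k$. Ground metric: for $\bm{\xi} = (\bm{x},\bm{z},y)$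 and $\bm{\xi}' = (\bm{x}',\bm{z}',y')$ in $\Xi$, $$d(\bm{\xi},\bm{\xi}') = \|\bm{x}-\bm{x}'\| + d_{\text{C}}(\bm{z},\bm{z}') + \kappa \cdot \mathbf{1}[y \neq y'], \qquad d_{\text{C}}(\bm{z},\bm{z}') = \Big(\sum_{j \in [m]} \mathbf{1}[\bm{z}_j \neq \bm{z}'_j]\Big)^{1/p},$$ where $\|\cdot\|$ is any rational norm on $\mathbb{R}^n$, $\kappa > 0$ is the output label weight and $p > 0$. Ambiguity set: $\widehat{\mathbb{P}}_N = \frac{1}{N} \sum_{i=1}^N \delta_{\bm{\xi}^i}$ and $\mathfrak{B}_\epsilon(\widehat{\mathbb{P}}_N) = \{\mathbb{Q} \in \mathcal{P}_0(\Xi) : \mathrm{W}(\mathbb{Q}, \widehat{\mathbb{P}}_N) \leq \epsilon\}$ with radius $\epsilon > 0$, where the type-1 Wasserstein distance $\mathrm{W}(\mathbb{Q},\mathbb{P})$ is the infimum of $\int_{\Xi^2} d(\bm{\xi},\bm{\xi}') \, \Pi(\mathrm{d}\bm{\xi},\mathrm{d}\bm{\xi}')$ over all $\Pi \in \mathcal{P}_0(\Xi^2)$ with first marginal $\mathbb{Q}$ and second marginal $\mathbb{P}$. *)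

(* Defs.v *)
From HB Require Import structures.
From mathcomp Require Import all_boot all_order all_algebra.
From mathcomp Require Import all_classical all_reals all_analysis.

Set Implicit Arguments.
Unset Strict Implicit.
Unset Printing Implicit Defensive.

Import Order.TTheory GRing.Theory Num.Theory.
Import numFieldNormedType.Exports.

Local Open Scope classical_set_scope.
Local Open Scope ring_scope.

(* The all-zero vector is a valid code, so that s values need s - 1 bits. *)
Definition is_onehot (s : nat) (z : {ffun 'I_s.-1 -> bool}) : bool :=
  (\sum_(l < s.-1) z l <= 1)%N.

Definition onehot (s : nat) : Type := {z | @is_onehot s z}.
HB.instance Definition _ s := Finite.on (onehot s).

Lemma is_onehot0 s : @is_onehot s [ffun=> false].
Proof. by rewrite /is_onehot big1// => l _; rewrite ffunE. Qed.

Definition onehot0 s : onehot s := exist (@is_onehot s) _ (is_onehot0 s).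

Definition catfeat (m : nat) (k : 'I_m -> nat) : Type :=
  {dffun forall j : 'I_m, onehot (k j)}.
HB.instance Definition _ m (k : 'I_m -> nat) := Finite.on (catfeat k).
HB.instance Definition _ m (k : 'I_m -> nat) :=
  isPointed.Build (catfeat k) (finfun (fun j => onehot0 (k j))).
HB.instance Definition _ m (k : 'I_m -> nat) :=
  @isMeasurable.Build default_measure_display (catfeat k)
    discrete_measurable discrete_measurable0
    discrete_measurableC discrete_measurableU.

Definition numfeat (R : realType) (n : nat) : Type :=
  g_sigma_algebraType (@open 'rV[R]_n).
HB.instance Definition _ (R : realType) n := Measurable.on (numfeat R n).

(* The label is a Boolean: true stands for +1 and false for -1. *)
Definition label_val (R : realType) (y : bool) : R := if y then 1 else -1.

Definition sample (R : realType) (n m : nat) (k : 'I_m -> nat) : Type :=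
  (numfeat R n * catfeat k * bool)%type.
HB.instance Definition _ (R : realType) n m (k : 'I_m -> nat) :=
  Measurable.on (sample R n k).

(* A categorical vector as an element of R ^ (k_1 + ... + k_m - m). *)
Definition catvec (R : realType) (m : nat) (k : 'I_m -> nat) (z : catfeat k) :
    'rV[R]_(\sum_(j < m) (k j).-1) :=
  \mxrow_(j < m) (\row_(l < (k j).-1) (val (z j) l)%:R).

Definition coef (R : realType) (n m : nat) (k : 'I_m -> nat) : Type :=
  (R * 'rV[R]_n * 'rV[R]_(\sum_(j < m) (k j).-1))%type.

Definition logloss (R : realType) (n m : nat) (k : 'I_m -> nat)
    (beta : coef R n k) (xi : sample R n k) : R :=
  let: (b0, bN, bC) := beta in
  let: (x, z, y) := xi in
  ln (1 + expR (- label_val R y *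
    (b0 + (bN *m (x : 'rV[R]_n)^T) 0 0 + (bC *m (catvec R z)^T) 0 0))).

Record is_norm (R : realType) (n : nat) (nrm : 'rV[R]_n -> R) : Prop := IsNorm {
  norm_eq0 : forall x, nrm x = 0 -> x = 0 ;
  norm_scale : forall a x, nrm (a *: x) = `|a| * nrm x ;
  norm_triangle : forall x y, nrm (x + y) <= nrm x + nrm y }.

Definition cat_dist (R : realType) (m : nat) (k : 'I_m -> nat) (p : R)
    (z z' : catfeat k) : R :=
  (\sum_(j < m) (z j != z' j)%:R) `^ p^-1.

Definition ground_dist (R : realType) (n m : nat) (k : 'I_m -> nat)
    (nrm : 'rV[R]_n -> R) (p kappa : R) (xi xi' : sample R n k) : R :=
  let: (x, z, y) := xi in
  let: (x', z', y') := xi' in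
  nrm ((x : 'rV[R]_n) - x') + cat_dist p z z' + kappa * (y != y')%:R.

Section wasserstein.
Local Open Scope ereal_scope.
Context (d : measure_display) (T : measurableType d) (R : realType).

Definition is_coupling (Q P : probability T R)
    (Pi : probability (T * T)%type R) : Prop :=
  forall A : set T, measurable A ->
    pushforward Pi fst A = Q A /\ pushforward Pi snd A = P A.

Definition wasserstein (c : T -> T -> R) (Q P : probability T R) : \bar R :=
  ereal_inf [set \int[Pi]_w (c w.1 w.2)%:E | Pi in is_coupling Q P].

Definition wasserstein_ball (c : T -> T -> R) (P : probability T R) (eps : R) :
    set (probability T R) :=
  [set Q | wasserstein c Q P <= eps%:E].

End wasserstein.

Section empirical.
Local Open Scope ereal_scope.
Context (d : measure_display) (T : measurableType d) (R : realType) (N : nat).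
Variable xi : 'I_N.+1 -> T.

(* The number of data points is N.+1, hence positive. *)
Definition empirical (A : set T) : \bar R :=
  (N.+1%:R^-1)%R%:E * \sum_(i < N.+1) \d_(xi i) A.

Let empiricalE : empirical = mscale (N.+1%:R^-1)%:nng%R
  (msum (fun i : nat => \d_(xi (inord i)) : {measure set T -> \bar R}) N.+1).
Proof.
apply/funext => A; rewrite /empirical /mscale /msum; congr (_ * _).
by apply: eq_bigr => i _; rewrite inord_val.
Qed.

Let empirical0 : empirical set0 = 0.
Proof. by rewrite empiricalE measure0. Qed.

Let empirical_ge0 A : 0 <= empirical A.
Proof. by rewrite empiricalE measure_ge0. Qed.

Let empirical_sigma_additive : semi_sigma_additive empirical.
Proof. by rewrite empiricalE; exact: measure_semi_sigma_additive. Qed.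

HB.instance Definition _ := isMeasure.Build _ _ _ empirical
  empirical0 empirical_ge0 empirical_sigma_additive.

Let empirical_setT : empirical setT = 1.
Proof.
rewrite /empirical (eq_bigr (fun=> 1%:E)) => [|i _]; last by rewrite diracT.
by rewrite sumEFin sumr_const card_ord -EFinM mulVf// pnatr_eq0.
Qed.

HB.instance Definition _ :=
  Measure_isProbability.Build _ _ _ empirical empirical_setT.

End empirical.

(* An unconstrained minimization problem over beta is represented by its
   extended-real objective function; Reg does not depend on the data xi. *)
Section objectives.
Local Open Scope ereal_scope.
Context (R : realType) (n m : nat) (k : 'I_m -> nat) (N : nat).
Variable xi : 'I_N.+1 -> sample R n k.

Definition dro_objective (nrm : 'rV[R]_n -> R) (p eps kappa : R)
    (beta : coef R n k) : \bar R :=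
  ereal_sup [set 'E_Q[logloss beta] | Q in
    wasserstein_ball (ground_dist nrm p kappa) (empirical R xi) eps].

Definition reg_objective (Reg : coef R n k -> R) (beta : coef R n k) : \bar R :=
  'E_(empirical R xi)[logloss beta] + (Reg beta)%:E.

End objectives.

(* Main.v *)
(* Take beta with zero intercept and numerical part, and a categorical part
   that gives the code z1 the positive score t and the code z0 = 0 the score 0,
   where all scores lie in [0, t].  A data-independent regularizer would make
   the excess of the worst-case risk over the empirical risk the same for every
   data set; compare the data set constantly (0, z1, +1) with the one constantly
   (0, z0, +1).
   - Moving mass a = min(1, eps / kappa) to the flipped label raises the loss of
     the first by a t, since ln(1 + e^t) - ln(1 + e^-t) = t.  For the second,
     +1 labels never exceed its loss ln 2, and any distribution in the ball has
     mass at most a on -1 labels, so its excess is at most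
     a (ln(1 + e^t) - ln 2) < a t.
   - As kappa tends to +oo the second excess vanishes, but on the first data set
     one can still move z1 to z0 at a cost independent of kappa. *)
From HB Require Import structures.
Require Import Defs.
From mathcomp Require Import all_boot all_order all_algebra.
From mathcomp Require Import all_classical all_reals all_analysis.
From mathcomp Require Import measurable_realfun lra.
Import Order.TTheory GRing.Theory Num.Theory.
Import numFieldNormedType.Exports.
Local Open Scope classical_set_scope.
Local Open Scope ring_scope.

Set Implicit Arguments.
Unset Strict Implicit.
Unset Printing Implicit Defensive.

(** * Integrals of nonnegative functions without measurability *)

Section integral.
Local Open Scope ereal_scope.
Import HBNNSimple.

(* Unlike [ge0_le_integral], no measurability: [ground_dist] is not known to be
   measurable. *)
Lemma ge0_le_integralT d (T : measurableType d) (R : realType)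
    (mu : {measure set T -> \bar R}) (f g : T -> \bar R) :
  (forall x, 0 <= f x) -> (forall x, f x <= g x) ->
  \int[mu]_x f x <= \int[mu]_x g x.
Proof.
move=> f0 fg; have g0 x : 0 <= g x := le_trans (f0 x) (fg x).
rewrite !ge0_integralTE//; apply: le_ereal_sup => _ /= [h hf <-].
by exists h => // x; exact: le_trans (hf x) (fg x).
Qed.

(** The integral of [f] is a supremum over simple functions below [f]. Each of these obeys the
    change of variables exactly, and its pullback lies below [f \o phi]. *)
Lemma ge0_integral_distribution_le d1 d2 (X : measurableType d1)
    (Y : measurableType d2) (R : realType) (P : probability X R)
    (phi : {mfun X >-> Y}) (f : Y -> \bar R) :
  (forall y, 0 <= f y) ->
  \int[distribution P phi]_y f y <= \int[P]_x f (phi x).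
Proof.
move=> f0; rewrite ge0_integralTE//; apply: ge_ereal_sup => _ /= [h hf <-].
rewrite -integralT_nnsfun ge0_integral_distribution//=.
- by apply: ge0_le_integralT => x /=; [rewrite lee_fin|exact: hf].
- exact/measurable_EFinP.
- by move=> y; rewrite lee_fin.
Qed.

End integral.

(** * Distributions with two atoms *)

Section two_point.
Context d (T : measurableType d) (R : realType).
Implicit Types (a : R) (u v : T).

Definition two_point_fun u v (b : bool) : T := if b then v else u.

Lemma measurable_two_point_fun u v : measurable_fun setT (two_point_fun u v).
Proof. by []. Qed.

HB.instance Definition _ u v :=
  isMeasurableFun.Build _ _ _ _ _ (measurable_two_point_fun u v).

(** As the image of a Bernoulli law this is a probability measure by construction; [v] receives the
    mass [a] that is moved away from [u]. *)
Definition two_point a u v : probability T R :=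
  distribution (bernoulli_prob a) (two_point_fun u v).

Local Open Scope ereal_scope.

Lemma two_pointE a u v A : (0 <= a <= 1)%R ->
  two_point a u v A = a%:E * \d_v A + (1 - a)%:E * \d_u A.
Proof.
by move=> a01; rewrite /= /distribution /pushforward bernoulli_probE.
Qed.

Lemma ge0_integral_two_point a u v (f : T -> \bar R) : (0 <= a <= 1)%R ->
  measurable_fun setT f -> (forall x, 0 <= f x) ->
  \int[two_point a u v]_x f x = a%:E * f v + (1 - a)%:E * f u.
Proof.
move=> a01 mf f0; rewrite ge0_integral_distribution//.
by rewrite integral_bernoulli_prob//= => b; exact: f0.
Qed.

Lemma ge0_integral_two_point_le a u v (f : T -> \bar R) : (0 <= a <= 1)%R ->
  (forall x, 0 <= f x) ->
  \int[two_point a u v]_x f x <= a%:E * f v + (1 - a)%:E * f u.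
Proof.
move=> a01 f0; apply: le_trans; first exact: ge0_integral_distribution_le.
by rewrite integral_bernoulli_prob//= => b; exact: f0.
Qed.

End two_point.

(** * Upper and lower bounds on the transport cost *)

Section wasserstein_bounds.
Context d (T : measurableType d) (R : realType).
Variables (c : T -> T -> R) (P : probability T R).
Hypothesis c_ge0 : forall x y, 0 <= c x y.
Local Open Scope ereal_scope.

(** The coupling that puts mass [a] on [(v, u)] and leaves the rest on [(u, u)] pays only for the
    moved mass. *)
Lemma wasserstein_two_point (a : R) (u v : T) :
  (0 <= a <= 1)%R -> c u u = 0%R ->
  (forall A, measurable A -> P A = \d_u A) ->
  wasserstein c (two_point a u v) P <= (a * c v u)%:E.
Proof.
move=> a01 cuu Pu; apply: ge_ereal_inf.
exists (\int[two_point a (u, u) (v, u)]_w (c w.1 w.2)%:E); last first.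
  apply: le_trans (ge0_integral_two_point_le _ _ a01 _) _ => /=.
    by move=> w; rewrite lee_fin.
  by rewrite cuu mule0 adde0 EFinM.
exists (two_point a (u, u) (v, u)) => // A mA.
rewrite !two_pointE// Pu// /pushforward; split.
  by rewrite two_pointE.
by rewrite two_pointE// -muleDl// -EFinD addrC subrK mul1e.
Qed.

(** Since [P] gives [S] no mass, all the mass of [Q] in [S] comes from outside [S] and pays at least
    [kappa] per unit. *)
Lemma wasserstein_ge (Q : probability T R) (S : set T) (kappa : R) :
  measurable S -> (0 <= kappa)%R -> P S = 0 ->
  (forall x y, S x -> ~ S y -> kappa <= c x y)%R ->
  kappa%:E * Q S <= wasserstein c Q P.
Proof.
move=> mS k0 PS ck; apply: le_ereal_inf_tmp => _ /= [Pi cPi <-].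
have [QS PS'] := cPi S mS.
pose A := fst @^-1` S `&` ~` (snd @^-1` S) : set (T * T).
have mfst : measurable (fst @^-1` S : set (T * T)).
  by rewrite -[X in measurable X]setTI; exact: measurable_fst.
have msnd : measurable (snd @^-1` S : set (T * T)).
  by rewrite -[X in measurable X]setTI; exact: measurable_snd.
have mA : measurable A by apply: measurableI => //; exact: measurableC.
(* Pairs whose second entry lies in [S] form a null set, because the second marginal is [P]; only
   the crossing pairs [A] remain. *)
have QA : Q S <= Pi A.
  rewrite -QS /pushforward.
  apply: le_trans (_ : Pi (snd @^-1` S `|` A) <= _).
    apply: le_measure; rewrite ?inE//; first exact: measurableU.
    by move=> w Sw; have [?|?] := pselect (S w.2); [left|right].
  apply: le_trans (measureU2 _ _ _) _ => //.
  by rewrite [X in X + _](_ : _ = 0) ?add0e// -PS -PS'.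
apply: (@le_trans _ _ (\int[Pi]_w (kappa%:E * (\1_A w)%:E))).
  rewrite ge0_integralZl_EFin//.
    by rewrite integral_indic// setIT; apply: lee_wpmul2l; rewrite ?lee_fin.
  by apply/measurable_EFinP; exact: measurable_indic.
apply: ge0_le_integralT => w; first by rewrite mule_ge0// lee_fin.
rewrite -EFinM lee_fin indicE.
have [|_] := boolP (w \in A); last by rewrite mulr0.
by rewrite in_setE mulr1 => -[/ck]; exact.
Qed.

End wasserstein_bounds.

(** * Expectations under the distributions in play *)

Section expectation_bounds.
Context d (T : measurableType d) (R : realType).
Local Open Scope ereal_scope.

Lemma expectation_le_indic (Q : probability T R) (X : T -> R) (S : set T)
    (b g : R) :
  measurable S -> (forall x, 0 <= X x)%R -> (0 <= b)%R -> (0 <= g)%R ->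
  (forall x, X x <= b + g * \1_S x)%R ->
  'E_Q[X] <= b%:E + g%:E * Q S.
Proof.
move=> mS X0 b0 g0 Xle; rewrite unlock.
have mI : measurable_fun setT (fun x => (\1_S x)%:E : \bar R).
  by apply/measurable_EFinP; exact: measurable_indic.
apply: (@le_trans _ _ (\int[Q]_x (b%:E + g%:E * (\1_S x)%:E))).
  by apply: ge0_le_integralT => x; rewrite ?lee_fin// -EFinM -EFinD lee_fin.
rewrite ge0_integralD//; last 2 first.
- by move=> x _; rewrite mule_ge0// lee_fin.
- exact: emeasurable_funM.
rewrite integral_cst// [X in _ * X + _](@probability_setT _ _ _ Q) mule1.
by rewrite ge0_integralZl_EFin ?integral_indic ?setIT.
Qed.

Lemma expectation_dirac (P : probability T R) (X : T -> R) (u : T) :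
  measurable_fun setT X -> (forall A, measurable A -> P A = \d_u A) ->
  'E_P[X] = (X u)%:E.
Proof.
move=> mX Pu; rewrite unlock (eq_measure_integral \d_u).
  by rewrite integral_dirac ?diracT ?mul1e//; exact/measurable_EFinP.
by move=> A mA _; exact: Pu.
Qed.

Lemma expectation_two_point (a : R) (u v : T) (X : T -> R) :
  (0 <= a <= 1)%R -> measurable_fun setT X -> (forall x, 0 <= X x)%R ->
  'E_(two_point a u v)[X] = (a * X v + (1 - a) * X u)%:E.
Proof.
move=> a01 mX X0; rewrite unlock ge0_integral_two_point//.
exact/measurable_EFinP.
Qed.

Lemma empirical_cst (N : nat) (u : T) (A : set T) :
  empirical R (fun _ : 'I_N.+1 => u) A = \d_u A.
Proof.
rewrite /empirical /= /dirac sumEFin sumr_const card_ord -EFinM.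
by rewrite -[X in (_ * X)%:E]mulr_natl mulrA mulVf ?mul1r ?pnatr_eq0.
Qed.

End expectation_bounds.

(** * Norms, categorical codes and the loss of the chosen coefficients *)

Lemma is_norm_ge0 (R : realType) (n : nat) (nrm : 'rV[R]_n -> R) x :
  is_norm nrm -> 0 <= nrm x.
Proof.
move=> nrmP; have nrmN y : nrm (- y) = nrm y.
  by rewrite -scaleN1r (norm_scale nrmP) normrN1 mul1r.
have := norm_triangle nrmP x (- x).
rewrite subrr nrmN -(scale0r 0) (norm_scale nrmP) normr0 mul0r.
by rewrite -mulr2n pmulrn_lge0.
Qed.

Lemma is_onehot1 s : @is_onehot s [ffun l : 'I_s.-1 => l == 0%N :> nat].
Proof.
rewrite /is_onehot; case: s.-1 => [|s']; first by rewrite big_ord0.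
rewrite big_ord_recl ffunE/= big1// => l _.
by rewrite ffunE.
Qed.

Definition onehot1 s : onehot s := exist (@is_onehot s) _ (is_onehot1 s).

Section sample.
Context (R : realType) (n m : nat) (k : 'I_m -> nat).
Implicit Types (z : catfeat k) (y : bool) (xi : sample R n k).

Lemma catvec_dot (z z' : catfeat k) :
  (catvec R z *m (catvec R z')^T) 0 0 =
  \sum_(j < m) \sum_(l < (k j).-1) (val (z j) l && val (z' j) l)%:R.
Proof.
rewrite /catvec tr_mxrow mul_mxrow_mxcol summxE; apply: eq_bigr => j _.
by rewrite mxE; apply: eq_bigr => l _; rewrite !mxE -natrM mulnb.
Qed.

Definition catfeat0 : catfeat k := finfun (fun j => onehot0 (k j)).

Definition catfeat1 : catfeat k := finfun (fun j => onehot1 (k j)).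

(** When every [k j] is at least 2, this counts the features on which [z] agrees with [catfeat1]. *)
Definition score z : R := (catvec R catfeat1 *m (catvec R z)^T) 0 0.

Lemma score_ge0 z : 0 <= score z.
Proof.
by rewrite /score catvec_dot; apply: sumr_ge0 => j _; apply: sumr_ge0 => l _.
Qed.

Lemma score_le z : score z <= score catfeat1.
Proof.
rewrite /score !catvec_dot; apply: ler_sum => j _; apply: ler_sum => l _.
by rewrite andbb ler_nat; case: andP => // -[->].
Qed.

Lemma score0 : score catfeat0 = 0.
Proof.
rewrite /score catvec_dot big1// => j _; rewrite big1// => l _.
by rewrite [catfeat0 j]ffunE /= [in X in _ && X]ffunE andbF.
Qed.

Lemma score1_gt0 : (0 < m)%N -> (forall j, (2 <= k j)%N) ->
  0 < score catfeat1.
Proof.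
move=> m0 k2; rewrite /score catvec_dot.
have kj (j : 'I_m) : (0 < (k j).-1)%N by have := k2 j; case: (k j) => [|[]].
rewrite (bigD1 (Ordinal m0))//= (bigD1 (Ordinal (kj (Ordinal m0))))//=.
rewrite [catfeat1 _]ffunE /= ffunE/= -addrA ltr_pwDl//.
by apply: addr_ge0; apply: sumr_ge0 => // j _; apply: sumr_ge0.
Qed.

Definition cat_coef : coef R n k := (0, 0, catvec R catfeat1).

Lemma logloss_cat (x : numfeat R n) z y :
  logloss cat_coef (x, z, y) = ln (1 + expR (- label_val R y * score z)).
Proof. by rewrite /logloss/= mul0mx mxE !add0r. Qed.

Lemma logloss_ge0 (beta : coef R n k) xi : 0 <= logloss beta xi.
Proof.
case: beta xi => -[b0 bN] bC [[x z] y].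
by rewrite /logloss ln_ge0// lerDl expR_ge0.
Qed.

Lemma measurable_catfeat (f : catfeat k -> R) : measurable_fun setT f.
Proof. by []. Qed.

(** The numerical coefficients vanish, so the loss factors through the discrete components of a
    sample. *)
Lemma measurable_logloss_cat : measurable_fun setT (logloss cat_coef).
Proof.
pose f y z : R := ln (1 + expR (- label_val R y * score z)).
have -> : logloss cat_coef = fun xi : sample R n k =>
    if xi.2 then f true xi.1.2 else f false xi.1.2.
  by apply/funext => -[[x z] []]; rewrite logloss_cat.
have m12 : measurable_fun setT (fun xi : sample R n k => xi.1.2).
  exact: measurableT_comp measurable_snd measurable_fst.
by apply: measurable_fun_if => //; apply: measurable_funTS;
  apply: (measurableT_comp _ m12); exact: measurable_catfeat.
Qed.

Definition sample_at z y : sample R n k := (0, z, y).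

(** * The ground metric and bounds on the worst-case risk *)

Section ground_dist.
Variables (nrm : 'rV[R]_n -> R) (p kappa : R).
Hypotheses (nrmP : is_norm nrm) (p_gt0 : 0 < p) (kappa_gt0 : 0 < kappa).

Lemma cat_dist_ge0 z z' : 0 <= cat_dist p z z' :> R.
Proof. exact: powR_ge0. Qed.

Lemma cat_distxx z : cat_dist p z z = 0 :> R.
Proof.
rewrite /cat_dist big1 => [|j _]; last by rewrite eqxx.
(* The exponent has to be nonzero, as 0 to the power 0 is 1; this is where [p_gt0] enters. *)
by rewrite powR0// invr_eq0 gt_eqF.
Qed.

Lemma ground_dist_ge0 xi xi' : 0 <= ground_dist nrm p kappa xi xi'.
Proof.
case: xi xi' => [[x z] y] [[x' z'] y'] /=.
by rewrite !addr_ge0 ?is_norm_ge0 ?cat_dist_ge0// mulr_ge0// ltW.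
Qed.

Lemma ground_dist_sample_at z y z' y' :
  ground_dist nrm p kappa (sample_at z y) (sample_at z' y') =
  cat_dist p z z' + kappa * (y != y')%:R.
Proof.
rewrite /= subrr -[X in nrm X](scale0r (0 : 'rV[R]_n)) (norm_scale nrmP).
by rewrite normr0 mul0r add0r.
Qed.

Lemma le_ground_dist xi xi' : xi.2 != xi'.2 ->
  kappa <= ground_dist nrm p kappa xi xi'.
Proof.
case: xi xi' => [[x z] y] [[x' z'] y'] /= ->; rewrite mulr1 lerDr.
by rewrite addr_ge0 ?is_norm_ge0 ?cat_dist_ge0.
Qed.

Variables (N : nat) (eps : R).
Local Notation data z y := (fun _ : 'I_N.+1 => sample_at z y).
Local Notation dro z y := (dro_objective (data z y) nrm p eps kappa cat_coef).

Lemma dro_objective_ge (a : R) z y z' y' : 0 <= a <= 1 ->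
  a * ground_dist nrm p kappa (sample_at z' y') (sample_at z y) <= eps ->
  ((a * logloss cat_coef (sample_at z' y') +
    (1 - a) * logloss cat_coef (sample_at z y))%:E <= dro z y)%E.
Proof.
move=> a01 aeps; apply: ereal_sup_ubound.
exists (two_point a (sample_at z y) (sample_at z' y')); last first.
  rewrite expectation_two_point//; first exact: measurable_logloss_cat.
  exact: logloss_ge0.
rewrite /wasserstein_ball /=.
apply: le_trans; first apply: wasserstein_two_point a01 _ _.
- exact: ground_dist_ge0.
- by rewrite ground_dist_sample_at cat_distxx eqxx mulr0 addr0.
- by move=> A _; exact: empirical_cst.
- by rewrite lee_fin.
Qed.

(** Scores are nonnegative, so only samples labelled -1 can lose more than [ln 2], and
    [wasserstein_ge] bounds their mass by [eps / kappa]. *)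
Lemma dro_objective_le : 0 <= eps ->
  (dro catfeat0 true <= (ln 2 + (ln (1 + expR (score catfeat1)) - ln 2) *
     Num.min 1 (eps / kappa))%:E)%E.
Proof.
move=> eps0; apply: ge_ereal_sup => _ /= [Q Qball <-].
pose S : set (sample R n k) := [set xi | xi.2 = false].
have mS : measurable S.
  rewrite (_ : S = snd @^-1` [set false]) // -[X in measurable X]setTI.
  exact: measurable_snd.
have QS_le : (Q S <= (Num.min 1 (eps / kappa))%:E)%E.
  have kQ : (kappa%:E * Q S <= eps%:E)%E.
    apply: le_trans Qball; apply: wasserstein_ge => //.
    - exact: ground_dist_ge0.
    - exact: ltW.
    - by apply: etrans; [exact: empirical_cst|rewrite diracE memNset].
    - move=> x y /= x2 y2; apply: le_ground_dist.
      by rewrite x2; move: y2; rewrite /S /=; case: y.2 => // /(_ erefl).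
  rewrite EFin_min le_min probability_le1//=.
  by rewrite EFinM muleC lee_pdivlMl.
set G := ln _ - ln 2.
have G0 : 0 <= G.
  rewrite subr_ge0 ler_ln ?posrE ?addr_gt0 ?expR_gt0//.
  by rewrite (_ : 2 = 1 + 1)// lerD2l -expR0 ler_expR score_ge0.
apply: (@le_trans _ _ ((ln 2)%:E + G%:E * Q S)%E); last first.
  rewrite [leRHS]EFinD; apply: leeD2l.
  by rewrite EFinM; apply: lee_wpmul2l; rewrite ?lee_fin.
apply: expectation_le_indic => //.
- exact: logloss_ge0.
- by rewrite ln_ge0// ler1n.
- move=> -[[x z] y]; rewrite logloss_cat indicE.
  case: y => /=.
    rewrite memNset// mulr0 addr0 mulN1r ler_ln ?posrE ?addr_gt0 ?expR_gt0//.
    by rewrite (_ : 2 = 1 + 1)// lerD2l -expR0 ler_expR oppr_le0 score_ge0.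
  rewrite mem_set// mulr1 [leRHS]addrC subrK opprK mul1r.
  by rewrite ler_ln ?posrE ?addr_gt0 ?expR_gt0// lerD2l ler_expR score_le.
Qed.

Lemma reg_objective_data Reg z y :
  reg_objective (data z y) Reg cat_coef =
  (logloss cat_coef (sample_at z y) + Reg cat_coef)%:E.
Proof.
rewrite /reg_objective (expectation_dirac (u := sample_at z y))//.
  exact: measurable_logloss_cat.
by move=> A _; exact: empirical_cst.
Qed.

End ground_dist.

End sample.

(** The growing weight is read in two ways: every finite [kappa], where [Reg] may depend on [kappa],
    and the pointwise limit of the objectives. *)
Theorem theorem3 (R : realType) (n m : nat) (k : 'I_m -> nat) (N : nat)
    (nrm : 'rV[R]_n -> R) (p eps : R) :
  (0 < m)%N -> (forall j, (2 <= k j)%N) ->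
  is_norm nrm -> 0 < p -> 0 < eps ->
  (forall kappa : R, 0 < kappa ->
     ~ exists Reg : coef R n k -> R,
         forall (xi : 'I_N.+1 -> sample R n k) (beta : coef R n k),
           dro_objective xi nrm p eps kappa beta = reg_objective xi Reg beta)
  /\
  ~ (exists Reg : coef R n k -> R,
       forall (xi : 'I_N.+1 -> sample R n k) (beta : coef R n k),
         dro_objective xi nrm p eps kappa beta @[kappa --> +oo]
           --> reg_objective xi Reg beta).
Proof.
move=> m0 k2 nrmP p0 eps0.
set t := score R (@catfeat1 m k).
have t0 : 0 < t by exact: score1_gt0.
have et1 : 1 < expR t by rewrite expR_gt1.
set z1 := @catfeat1 m k; set z0 := @catfeat0 m k.
set lu := ln (1 + expR (- t)); set lv := ln (1 + expR t).
have luE : logloss (cat_coef R n k) (sample_at R n z1 true) = lu.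
  by rewrite logloss_cat mulN1r.
have lvE : logloss (cat_coef R n k) (sample_at R n z1 false) = lv.
  by rewrite logloss_cat opprK mul1r.
have l0E y : logloss (cat_coef R n k) (sample_at R n z0 y) = ln 2.
  by rewrite logloss_cat score0 mulr0 expR0.
(* This is (1 + e^-t) e^t = 1 + e^t. *)
have lvu : lv = lu + t.
  rewrite -[t in RHS]expRK -lnM ?posrE ?addr_gt0 ?expR_gt0// mulrDl mul1r.
  by rewrite -expRD addNr expR0 addrC.
(* This is 1 + e^t < 2 e^t. *)
have lv_lt : lv < ln 2 + t.
  rewrite -[t in ltRHS]expRK -lnM ?posrE ?expR_gt0//.
  rewrite ltr_ln ?posrE ?addr_gt0 ?mulr_gt0 ?expR_gt0//.
  lra.
have lu_lt : lu < ln 2 by lra.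
have lv_gt : ln 2 < lv by rewrite ltr_ln ?posrE ?addr_gt0 ?expR_gt0//; lra.
(* The same [r] serves both data sets, since [Reg] does not see the data. *)
split=> [kappa kappa0|] [Reg RegP]; set r := Reg (cat_coef R n k) in RegP *.
  set a := Num.min 1 (eps / kappa).
  have a0 : 0 < a by rewrite lt_min ltr01 divr_gt0.
  have a1 : a <= 1 by rewrite ge_min lexx.
  have ak : a * kappa <= eps by rewrite -ler_pdivlMr// ge_min lexx orbT.
  have := @dro_objective_le R n m k nrm p kappa nrmP kappa0 N eps (ltW eps0).
  rewrite RegP reg_objective_data l0E lee_fin -/a -/lv => Hle.
  have := @dro_objective_ge R n m k nrm p kappa nrmP p0 kappa0 N eps a z1 true
    z1 false.
  rewrite RegP reg_objective_data ground_dist_sample_at// cat_distxx//.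
  rewrite add0r mulr1 luE lvE lee_fin (ltW a0) a1 => /(_ isT ak) Hge.
  (* The bounds read a t <= r <= a (lv - ln 2), against [lv_lt]. *)
  rewrite -/r in Hle Hge; nra.
set D : R := cat_dist p z0 z1.
have D0 : 0 <= D by exact: cat_dist_ge0.
(* A mass that can be moved from [z1] to [z0] for every [kappa]; adding 1 keeps the denominator
   positive given only [D0]. *)
set a := Num.min 1 (eps / (D + 1)).
have a0 : 0 < a by rewrite lt_min ltr01 divr_gt0// ltr_wpDl.
have a1 : a <= 1 by rewrite ge_min lexx.
have aD : a * D <= eps.
  have : a * (D + 1) <= eps.
    by rewrite -ler_pdivlMr ?ltr_wpDl// ge_min lexx orbT.
  nra.
have Hge : a * ln 2 + (1 - a) * lu <= lu + r.
  rewrite -lee_fin -luE -(@reg_objective_data R n m k N) -(l0E true).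
  apply: cvge_ge (RegP _ _); near=> kappa.
  have kappa0 : 0 < kappa by near: kappa; exact: nbhs_pinfty_gt.
  apply: dro_objective_ge => //; first by rewrite ltW.
  by rewrite ground_dist_sample_at// eqxx mulr0 addr0.
have c0 : 0 < a * (ln 2 - lu) by rewrite mulr_gt0// subr_gt0.
(* The excess (lv - ln 2) eps / kappa tends to 0, so it eventually falls below half of the positive
   lower bound on [r] given by [Hge]. *)
have Hle : ln 2 + r <= ln 2 + a * (ln 2 - lu) / 2.
  rewrite -lee_fin -[X in X + r](l0E true) -(@reg_objective_data R n m k N).
  apply: cvge_le (RegP _ _); near=> kappa.
  have kappa0 : 0 < kappa by near: kappa; exact: nbhs_pinfty_gt.
  apply: le_trans; first exact: dro_objective_le (ltW eps0).
  rewrite lee_fin lerD2l -/lv.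
  apply: (@le_trans _ _ ((lv - ln 2) * (eps / kappa))).
    by rewrite ler_wpM2l ?ge_min ?lexx ?orbT//; lra.
  rewrite mulrA ler_pdivrMr// [leRHS]mulrC -ler_pdivrMr; last first.
    by rewrite divr_gt0.
  by near: kappa; apply: nbhs_pinfty_ge; rewrite num_real.
lra.
Unshelve. all: by end_near. Qed.
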